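(* Let $E$ be the space of all sequences $x=(x_n)_{n\in\mathbb{N}}$ of real numbers which have polynomial growth, i.e., for which there exists $m\in\mathbb{N}$ such that the sequence $(|x_n|n^{-m})_{n\in\mathbb{N}}$ is bounded. Equip $E$ with the topology induced by the product $\mathbb{R}^{\mathbb{N}}$. Then the map $$f\colon\mathbb{R}\to E,\qquad f(t):=(\sin(nt))_{n\in\mathbb{N}}$$ is smooth and $f(t)=\sum_{k=0}^\infty\frac{f^{(k)}(t_0)}{k!}(t-t_0)^k$ in $E$, for all $t,t_0\in\mathbb{R}$. However, $f$ is not real analytic.
   Context: $\mathbb{N}=\{1,2,\ldots\}$, $\mathbb{N}_0=\mathbb{N}\cup\{0\}$. A map $f\colon\mathbb{R}\to E$ to a real locally convex space $E$ is smooth ($C^\infty_{\mathbb{R}}$) if it has continuous derivatives $f^{(k)}\colon\mathbb{R}\to E$ of all orders $k\in\mathbb{N}_0$, where $f^{(0)}=f$ and $f^{(k)}=(f^{(k-1)})'$, derivatives being limits of difference quotients in $E$. A map $f\colon U\to F$ from an open subset $U$ of a real locally convex space $X$ to a real locally convex space $F$ is called real analytic if it extends to a complex analytic $F_{\mathbb{C}}$-valued map on an open neighbourhood of $U$ in the complexification $X_{\mathbb{C}}$. In particular, for $X=U=\mathbb{R}$ this means that $f$ extends to a complex analytic map $V\to F_{\mathbb{C}}$ on some open neighbourhood $V$ of $\mathbb{R}$ in $\mathbb{C}$; here a map $h\colon V\to F_{\mathbb{C}}$ on an open set $V\subseteq\mathbb{C}$ is complex analytic if for each $z_0\in V$ there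 are $a_n\in F_{\mathbb{C}}$ such that $h(z)=\sum_{n=0}^\infty (z-z_0)^n a_n$ (convergent in $F_{\mathbb{C}}$) for all $z$ close to $z_0$. *)

(* Defs.v *)
From HB Require Import structures.
From mathcomp Require Import all_boot all_order all_algebra.
From mathcomp Require Import all_classical all_reals all_analysis.
From mathcomp Require Import ring.
From mathcomp.real_closed Require Import complex.

Set Implicit Arguments.
Unset Strict Implicit.
Unset Printing Implicit Defensive.

Import Order.TTheory GRing.Theory Num.Theory.
Import numFieldNormedType.Exports.

Local Open Scope classical_set_scope.
Local Open Scope ring_scope.
Local Open Scope complex_scope.

Section smooth_curves.
Context {R : realType} {E : tvsType R}.
Implicit Types (f : R -> E) (t : R).

Definition has_derivative f t (l : E) :=
  h^-1 *: (f (t + h) - f t) @[h --> 0^'] --> l.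

(* The library's [derive1] requires a normed codomain. The junk value 0 is
   excluded in [smooth_curve], which requires convergence at every order. *)
Definition curve_deriv f : R -> E := fun t => xget 0 (has_derivative f t).

Definition curve_derivn (k : nat) f : R -> E := iter k curve_deriv f.

Definition smooth_curve f := forall k : nat,
  continuous (curve_derivn k f) /\
  forall t, has_derivative (curve_derivn k f) t (curve_derivn k.+1 f t).

End smooth_curves.

Fact continuous_op2 (S A B T : topologicalType) (f : S -> A) (g : S -> B)
    (op : A * B -> T) : continuous op -> continuous f -> continuous g ->
  continuous (fun s => op (f s, g s)).
Proof.
move=> cop cf cg s; apply: (@continuous_comp _ _ _ (fun s => (f s, g s)) op).
  exact: cvg_pair (cf s) (cg s).
exact: cop.
Qed.

(* [(x, y)] stands for [x + i y]. *)
Definition complexification (F : Type) : Type := (F * F)%type.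

Section complexification_tvs.
Context {R : realType} {F : tvsType R}.
Local Notation FC := (complexification F).

HB.instance Definition _ := Uniform.copy FC (F * F)%type.
HB.instance Definition _ := GRing.Zmodule.copy FC (F * F)%type.

Definition complexification_scale (z : R[i]) (w : FC) : FC :=
  let: a +i* b := z in (a *: w.1 - b *: w.2, a *: w.2 + b *: w.1).

Fact complexification_scaleA a b w : complexification_scale a
  (complexification_scale b w) = complexification_scale (a * b) w.
Proof.
case: a b w => [a b] [c d] [x y]; rewrite /complexification_scale /=.
congr pair; rewrite !(scalerDr, scalerN, scalerA) !(scalerDl, scaleNr).
  by rewrite !opprD -!addrA; congr (_ + _); rewrite [RHS]addrC -addrA.
by rewrite -!addrA; congr (_ + _); rewrite [RHS]addrC -addrA.
Qed.

Fact complexification_scale1 : left_id 1 complexification_scale.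
Proof.
by case=> x y; rewrite /complexification_scale/= !scale1r !scale0r subr0 addr0.
Qed.

Fact complexification_scaleDr :
  right_distributive complexification_scale +%R.
Proof.
case=> [a b] [x y] [x' y']; rewrite /complexification_scale/=.
congr pair => /=; rewrite !scalerDr; last exact: addrACA.
by rewrite opprD; exact: addrACA.
Qed.

Fact complexification_scaleDl w :
  {morph complexification_scale^~ w : a b / a + b}.
Proof.
case: w => [x y] [a b] [c d]; rewrite /complexification_scale/=.
congr pair => /=; rewrite !scalerDl; last exact: addrACA.
by rewrite opprD; exact: addrACA.
Qed.

HB.instance Definition _ := GRing.Zmodule_isLmodule.Build R[i] FC
  complexification_scaleA complexification_scale1
  complexification_scaleDr complexification_scaleDl.

Let complexification_add_continuous :
  continuous (fun x : FC * FC => x.1 + x.2).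
Proof. exact: (@add_continuous (F * F)%type). Qed.

Let Re_continuous : continuous (@complex.Re R : R[i]^o -> R^o).
Proof.
move=> z; apply/(cvgrPdist_lt (FF := nbhs_filter (z : R[i]^o))) => e e0.
exists (e%:C); first by rewrite /= ltcR.
move=> w /= zw; rewrite -ltcR -raddfB/=.
exact: le_lt_trans (normc_ge_Re _) zw.
Qed.

Let Im_continuous : continuous (@complex.Im R : R[i]^o -> R^o).
Proof.
move=> z; apply/(cvgrPdist_lt (FF := nbhs_filter (z : R[i]^o))) => e e0.
exists (e%:C); first by rewrite /= ltcR.
move=> w /= zw; rewrite -ltcR -raddfB/=.
apply: le_lt_trans zw; case: (z - w) => a b.
by rewrite normc_def lecR/= -sqrtr_sqr ler_wsqrtr// lerDr sqr_ge0.
Qed.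

Let complexification_scale_continuous :
  continuous (fun z : R[i]^o * FC => z.1 *: z.2).
Proof.
have cRe : continuous (fun q : R[i]^o * FC => complex.Re q.1 : R^o).
  move=> p; apply: (@continuous_comp _ _ _ fst); last exact: Re_continuous.
  exact: cvg_fst.
have cIm : continuous (fun q : R[i]^o * FC => complex.Im q.1 : R^o).
  move=> p; apply: (@continuous_comp _ _ _ fst); last exact: Im_continuous.
  exact: cvg_fst.
have c1 : continuous (fun q : R[i]^o * FC => (q.2 : F * F).1).
  by move=> p; apply: (@continuous_comp _ _ _ snd fst);
    [exact: cvg_snd|exact: cvg_fst].
have c2 : continuous (fun q : R[i]^o * FC => (q.2 : F * F).2).
  by move=> p; apply: (@continuous_comp _ _ _ snd snd);
    [exact: cvg_snd|exact: cvg_snd].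
have -> : (fun z : R[i]^o * FC => z.1 *: z.2) = (fun z =>
   (complex.Re z.1 *: z.2.1 - complex.Im z.1 *: z.2.2,
    complex.Re z.1 *: z.2.2 + complex.Im z.1 *: z.2.1)).
  by apply/funext => -[[a b] [x y]].
have cZ := @scale_continuous R F.
move=> p; apply: cvg_pair.
  exact: (continuous_op2 (@sub_continuous F)
    (continuous_op2 cZ cRe c1) (continuous_op2 cZ cIm c2)).
exact: (continuous_op2 (@add_continuous F)
  (continuous_op2 cZ cRe c2) (continuous_op2 cZ cIm c1)).
Qed.


Let complexification_locally_convex :
  exists2 B : set_system FC, (forall b, b \in B -> convex_set b) & basis B.
Proof.
have [B cB bB] := @locally_convex R (F * F)%type.
exists B => // b /cB cb x y l xb yb.
have /andP[] : 0 <= l%:num <= 1 by rewrite ge0 le1.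
case lE : l%:num => [a c]; rewrite !lecE/=.
move=> /andP[/eqP c0 a0] /andP[_ a1].
pose k : {i01 R} := Itv01 a0 a1.
have reZ (r : R) (w : FC) : (r +i* 0) *: w = r *: (w : F * F).
  case: w => u v; rewrite /GRing.scale/= /complexification_scale/=.
  by rewrite !scale0r subr0 addr0.
have := cb x y k xb yb; congr (_ \in b).
rewrite /conv/= lE c0 [unstable.onem (a +i* _)](_ : _ = (1 - a) +i* 0).
  by rewrite !reZ.
by apply/eqP; rewrite eq_complex/= subr0 !eqxx.
Qed.

HB.instance Definition _ :=
  PreTopologicalNmodule_isTopologicalNmodule.Build FC
    complexification_add_continuous.
HB.instance Definition _ :=
  TopologicalNmodule_isTopologicalLmodule.Build R[i] FC
    complexification_scale_continuous.
HB.instance Definition _ :=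
  Uniform_isTvs.Build R[i] FC complexification_locally_convex.

End complexification_tvs.

Section analyticity.
Context {R : realType}.

(* [R[i]^o] is [R[i]] with the topology of the modulus. *)
Definition complex_analytic {G : tvsType R[i]} (V : set R[i]^o)
    (h : R[i] -> G) :=
  forall z0 : R[i]^o, V z0 -> exists a : nat -> G,
    \forall z \near z0, series (fun n => (z - z0) ^+ n *: a n) @ \oo --> h z.

(* Only the values of [h] on the open set [V] matter. *)
Definition real_analytic_curve {F : tvsType R} (f : R -> F) :=
  exists (V : set R[i]^o) (h : R[i] -> complexification F),
    [/\ open V, forall t : R, V t%:C, complex_analytic V h &
        forall t : R, h t%:C = (f t, 0)].

End analyticity.

Section polynomial_growth.
Context {R : realType}.

(* Sequences (x_n)_{n >= 1} are encoded as functions on [nat] shifted by one: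
   [x n] stands for x_{n+1}. *)
Definition polynomial_growth (x : nat -> R) := exists2 m : nat, (0 < m)%N &
  exists M : R, forall n : nat, `|x n| * n.+1%:R ^- m <= M.

Definition polygrowth : {pred nat -> R} := fun x => `[< polynomial_growth x >].

Fact polygrowth_submod : submod_closed polygrowth.
Proof.
have gec (n m k : nat) (c : R) : 0 <= c -> (m <= k)%N ->
    c * n.+1%:R ^- k <= c * n.+1%:R ^- m.
  move=> c0 mk; apply: ler_wpM2l => //.
  by rewrite lef_pV2 ?posrE ?exprn_gt0 ?ltr0n// ler_weXn2l// ler1n.
split.
  apply/asboolP; exists 1%N => //; exists 0 => n.
  by rewrite /= normr0 mul0r.
move=> a x y /asboolP[m m0 [M xM]] /asboolP[k k0 [N yN]].
apply/asboolP; exists (m + k)%N; first by rewrite addn_gt0 m0.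
exists (`|a| * M + N) => n.
have h0 : 0 <= n.+1%:R ^- (m + k) :> R by rewrite invr_ge0 exprn_ge0.
apply: le_trans (ler_wpM2r h0 (ler_normD _ _)) _.
rewrite mulrDl normrM -mulrA lerD//.
  by rewrite ler_wpM2l// (le_trans _ (xM n))// gec// leq_addr.
by rewrite (le_trans _ (yN n))// gec// leq_addl.
Qed.

HB.instance Definition _ :=
  GRing.isSubmodClosed.Build R (nat -> R^o) polygrowth polygrowth_submod.

End polynomial_growth.

Definition polygrowth_seq (R : realType) : Type := {x : nat -> R | x \in polygrowth}.

Section polygrowth_seq_tvs.
Context {R : realType}.
Local Notation E := (polygrowth_seq R).

HB.instance Definition _ := SubChoice.copy E {x : nat -> R | x \in polygrowth}.
HB.instance Definition _ := [SubChoice_isSubLmodule of E by <:].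

HB.instance Definition _ := Uniform.copy E
  (initial_topology (val : E -> {ptws nat -> R})).

Fact polygrowth_seq_coord_continuous (n : nat) :
  continuous (fun x : E => val x n : R).
Proof.
have cv : continuous (val : E -> {ptws nat -> R}).
  exact: (@initial_continuous E {ptws nat -> R} val).
have cp : continuous (fun u : {ptws nat -> R} => u n : R).
  exact: (@proj_continuous _ (fun=> R)).
by move=> x; exact: continuous_comp (cv x) (cp (val x)).
Qed.

Fact polygrowth_seq_cvgP (F : set_system E) {FF : Filter F} (x : E) :
  F --> x <-> forall n, (val y n : R) @[y --> F] --> (val x n : R).
Proof.
split => [Fx n|Fx].
  by apply: cvg_trans (@polygrowth_seq_coord_continuous n x); exact: cvg_app.
have vF : (val y : {ptws nat -> R}) @[y --> F] --> (val x : {ptws nat -> R}).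
  apply/cvg_sup => n A [_ [[B oB <-] Bx] sBA].
  apply: filterS sBA _; apply: (Fx n); exact: open_nbhs_nbhs.
move=> A [_ [[B oB <-] Bx] sBA]; apply: filterS sBA _.
by apply: vF; exact: open_nbhs_nbhs.
Qed.

Let polygrowth_seq_add_continuous : continuous (fun x : E * E => x.1 + x.2).
Proof.
move=> p; apply/(polygrowth_seq_cvgP (FF := fmap_filter _ (nbhs_filter p))) => n.
have c1 : continuous (fun q : E * E => val q.1 n : R).
  have cf : continuous (@fst E E) by move=> q; exact: cvg_fst.
  by move=> q; exact: continuous_comp (cf q)
    (@polygrowth_seq_coord_continuous n q.1).
have c2 : continuous (fun q : E * E => val q.2 n : R).
  have cs : continuous (@snd E E) by move=> q; exact: cvg_snd.
  by move=> q; exact: continuous_comp (cs q)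
    (@polygrowth_seq_coord_continuous n q.2).
exact: (continuous_op2 (@add_continuous R^o) c1 c2).
Qed.

Let polygrowth_seq_scale_continuous :
  continuous (fun z : R^o * E => z.1 *: z.2).
Proof.
move=> p; apply/(polygrowth_seq_cvgP (FF := fmap_filter _ (nbhs_filter p))) => n.
have c1 : continuous (fun q : R^o * E => q.1) by move=> q; exact: cvg_fst.
have c2 : continuous (fun q : R^o * E => val q.2 n : R).
  have cs : continuous (@snd R^o E) by move=> q; exact: cvg_snd.
  by move=> q; exact: continuous_comp (cs q)
    (@polygrowth_seq_coord_continuous n q.2).
exact: (continuous_op2 (@scale_continuous R R^o) c1 c2).
Qed.

Let polygrowth_seq_locally_convex :
  exists2 B : set_system E, (forall b, b \in B -> convex_set b) & basis B.
Proof.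
exists [set b | open b /\ convex_set b]; first by move=> b /set_mem[].
split=> [b []//|x].
pose G : set_system E :=
  filter_from [set b | [/\ open b, convex_set b & b x]] id.
suff : G --> x.
  by move=> Gx U /Gx[b [ob cb bx] bU]; exists b.
have GF : Filter G.
  apply: filter_from_filter.
    exists setT => //; split; [exact: openT| |by []].
    by move=> u v l _ _; rewrite in_setT.
  move=> b c [ob cb bx] [oc cc cx]; exists (b `&` c) => //; split; [exact: openI| |by []].
  move=> u v l /set_mem[bu cu] /set_mem[bv cv]; apply/mem_set; split.
    by apply/set_mem/cb; exact/mem_set.
  by apply/set_mem/cc; exact/mem_set.
apply/polygrowth_seq_cvgP => n U [e /= e0 eU].
exists [set y : E | `|val x n - val y n| < e]; last by move=> y; exact: eU.
split=> /=; last by rewrite subrr normr0.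
- have /continuousP := @polygrowth_seq_coord_continuous n.
  by move=> /(_ (ball (val x n) e)); apply; exact: ball_open.
- apply/convex_setW => u v /set_mem/= un /set_mem/= vn l l0 l1.
  apply/mem_set => /=.
  have -> : val x n - (l%:num * val u n + unstable.onem l%:num * val v n) =
      l%:num * (val x n - val u n) + unstable.onem l%:num * (val x n - val v n).
    by rewrite /unstable.onem; ring.
  rewrite (le_lt_trans (ler_normD _ _))// !normrM.
  rewrite (gtr0_norm l0) (@gtr0_norm _ (unstable.onem _)) ?subr_gt0//.
  rewrite [ltRHS](_ : e = l%:num * e + unstable.onem l%:num * e).
    by rewrite ltrD// ltr_pM2l// subr_gt0.
  by rewrite /unstable.onem; ring.
Qed.


HB.instance Definition _ :=
  PreTopologicalNmodule_isTopologicalNmodule.Build E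
    polygrowth_seq_add_continuous.
HB.instance Definition _ :=
  TopologicalNmodule_isTopologicalLmodule.Build R E
    polygrowth_seq_scale_continuous.
HB.instance Definition _ :=
  Uniform_isTvs.Build R E polygrowth_seq_locally_convex.

End polygrowth_seq_tvs.

Section sine_curve.
Context {R : realType}.

Fact sin_polygrowth (t : R) :
  (fun n : nat => sin (n.+1%:R * t)) \in polygrowth.
Proof.
apply/asboolP; exists 1%N => //; exists 1 => n.
rewrite -[leRHS]mulr1 ler_pM ?invr_ge0 ?ler0n//.
  by rewrite ler_norml sin_geN1 sin_le1.
by rewrite invf_le1 ?ltr0n ?ler1n.
Qed.

Definition sin_curve (t : R) : polygrowth_seq R :=
  exist _ (fun n => sin (n.+1%:R * t)) (sin_polygrowth t).

End sine_curve.

(* Main.v *)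
(** Since sin' is sin shifted by pi/2, the n-th coordinate of f^(k)(t) is
    n^k sin(nt + k pi/2), which grows polynomially in n; derivatives and Taylor
    series in E are computed coordinatewise.
    If f had an analytic extension h near 0, then uniqueness of real power
    series coefficients would identify the coordinates of its Taylor
    coefficients with those of sin(nt), on a disc that does not depend on n.
    At a point iy with y > 0 in that disc, the n-th coordinate of h(iy) would
    be i sinh(ny), which does not grow polynomially in n. *)

Require Import Defs.
From HB Require Import structures.
From mathcomp Require Import all_boot all_order all_algebra.
From mathcomp Require Import all_classical all_reals all_analysis.
From mathcomp Require Import ring lra.
From mathcomp.real_closed Require Import complex.

Set Implicit Arguments.
Unset Strict Implicit.
Unset Printing Implicit Defensive.

Import Order.TTheory GRing.Theory Num.Theory.
Import numFieldNormedType.Exports.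

Local Open Scope classical_set_scope.
Local Open Scope ring_scope.

(** * Uniqueness of the coefficients of a real power series *)

Section power_series_uniqueness.
Context {R : realType}.
Implicit Types (d e : nat -> R) (r t : R).

(** Convergence at [s = r / 2] bounds the terms [d n * s ^+ n] by some [C]. At [s * q] a geometric
    comparison then keeps the partial sums within [2 * C * q] of [d 0]; as they tend to 0, [d 0] is
    at most [2 * C * q] in modulus for all small [q]. *)
Lemma power_series_constant_coef_eq0 d r : 0 < r ->
  (forall t, 0 < t < r -> series (fun n => d n * t ^+ n) @ \oo --> (0 : R)) ->
  d 0%N = 0.
Proof.
move=> r0 d0; have s0 : 0 < r / 2 by rewrite divr_gt0.
set s := r / 2 in s0; have sr : 0 < s < r by rewrite s0/= /s; lra.
have [M [_ dM]] : bounded_fun (fun n => d n * s ^+ n).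
  by apply: cvg_series_bounded; apply/cvg_ex; exists 0; exact: d0.
pose C := `|M| + 1.
have C0 : 0 < C by rewrite /C ltr_pwDr.
have dC n : `|d n * s ^+ n| <= C.
  by apply: (dM C) => //; rewrite /C (le_lt_trans (ler_norm _))// ltrDl.
(* The factor [1 - q ^+ n] makes the induction close: from [n] to [n.+1] the bound grows by
   [C * q ^+ n.+1 * 2 * (1 - q)], which covers the new term since [q <= 1/2]. *)
have tail q n : 0 < q <= 2^-1 ->
    `|series (fun n => d n * (s * q) ^+ n) n.+1 - d 0%N| <=
    C * (2 * q) * (1 - q ^+ n).
  move=> /andP[q0 q2]; elim: n => [|n IHn].
    by rewrite seriesEnat/= big_nat1 !expr0 mulr1 !subrr normr0 mulr0.
  rewrite seriesSr addrAC (le_trans (ler_normD _ _))//.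
  have -> : C * (2 * q) * (1 - q ^+ n.+1) =
      C * (2 * q) * (1 - q ^+ n) + C * (q ^+ n.+1 * (2 * (1 - q))).
    by rewrite exprS; ring.
  rewrite lerD// exprMn mulrA normrM (ger0_norm (exprn_ge0 _ (ltW q0))).
  rewrite ler_pM// ?exprn_ge0 ?(ltW q0)//.
  by rewrite ler_peMr ?exprn_ge0 ?(ltW q0)//; lra.
have bnd q : 0 < q <= 2^-1 -> `|d 0%N| <= C * (2 * q).
  move=> /andP[q0 q2].
  have sq : 0 < s * q < r.
    rewrite mulr_gt0//= (le_lt_trans _ (_ : s < r))//; last by case/andP: sr.
    by rewrite ler_piMr// ?(ltW s0)//; lra.
  have cv : `|series (fun n => d n * (s * q) ^+ n) n.+1 - d 0%N| @[n --> \oo]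
      --> `|0 - d 0%N|.
    apply: cvg_norm; apply: cvgB; last exact: cvg_cst.
    by rewrite (cvg_shiftS (series (fun n => d n * (s * q) ^+ n))); exact: d0.
  rewrite sub0r normrN in cv; rewrite -(cvg_lim _ cv)//.
  apply: limr_le; first by apply/cvg_ex; exists `|d 0%N|.
  apply: nearW => n; apply: le_trans (tail _ _ _) _; first by rewrite q0.
  rewrite ler_piMr ?mulr_ge0 ?(ltW C0) ?(ltW q0)//.
  by rewrite lerBlDr lerDl exprn_ge0// ltW.
have [//|/negP d00] := boolP (d 0%N == 0); first by move/eqP.
have n0 : 0 < `|d 0%N| by rewrite normr_gt0; exact/negP.
(* This [q] makes the bound at most half of the modulus of [d 0], a contradiction. *)
have := bnd (Num.min 2^-1 (`|d 0%N| / (4 * C))).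
rewrite lt_min ge_min lexx !andbT invr_gt0 ltr0n/= divr_gt0 ?mulr_gt0//.
move=> /(_ isT); apply: contraTeq => _; rewrite -ltNge.
apply: le_lt_trans (_ : C * (2 * (`|d 0%N| / (4 * C))) < _).
  by rewrite ler_pM2l// ler_pM2l// ge_min lexx orbT.
have -> : C * (2 * (`|d 0%N| / (4 * C))) = `|d 0%N| / 2 by field; lra.
by lra.
Qed.

(** Once the constant coefficient vanishes, dividing by [t] gives the series of the shifted
    coefficients, again with sum 0. Staying away from [t = 0] makes the division legitimate. *)
Lemma power_series_eq0 d r : 0 < r ->
  (forall t, 0 < t < r -> series (fun n => d n * t ^+ n) @ \oo --> (0 : R)) ->
  forall n, d n = 0.
Proof.
move=> r0 + n; elim: n d => [|n IHn] d d0.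
  exact: power_series_constant_coef_eq0 r0 d0.
apply: (IHn (fun n => d n.+1)) => t tr.
have t0 : t != 0 by case/andP: tr => /lt0r_neq0.
rewrite [X in X @ _ --> _](_ : _ = (fun N =>
    t^-1 * (series (fun n => d n * t ^+ n) N.+1 - d 0%N))); last first.
  apply/funext => N; apply: (mulfI t0); rewrite mulVKf// !seriesEnat/=.
  rewrite big_nat_recl//= expr0 mulr1 addrAC subrr add0r mulr_sumr.
  by apply: eq_bigr => i _; rewrite exprS mulrCA.
rewrite [X in _ --> X](_ : _ = t^-1 * (0 - d 0%N)); last first.
  by rewrite (power_series_constant_coef_eq0 r0 d0) subrr mulr0.
apply: cvgMr; apply: cvgB; last exact: cvg_cst.
by rewrite (cvg_shiftS (series (fun n => d n * t ^+ n))); exact: d0.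
Qed.

Lemma power_series_inj d e r (l : R -> R) : 0 < r ->
  (forall t, 0 < t < r -> series (fun n => d n * t ^+ n) @ \oo --> l t) ->
  (forall t, 0 < t < r -> series (fun n => e n * t ^+ n) @ \oo --> l t) ->
  d =1 e.
Proof.
move=> r0 dl el n; apply/eqP; rewrite -subr_eq0; apply/eqP.
apply: (@power_series_eq0 (fun n => d n - e n) r r0) => t tr.
have -> : series (fun n => (d n - e n) * t ^+ n) =
    (fun N => series (fun n => d n * t ^+ n) N - series (fun n => e n * t ^+ n) N).
  apply/funext => N; rewrite !seriesEnat/= -sumrB.
  by apply: eq_bigr => i _; rewrite mulrBl.
by rewrite -[0](subrr (l t)); apply: cvgB; [exact: dl|exact: el].
Qed.

End power_series_uniqueness.

(** * Limits and derivatives in the sequence space, coordinate by coordinate *)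

Lemma is_derive1_cvg (R : realType) (f : R -> R) (x df : R) :
  is_derive x 1 f df -> h^-1 * (f (x + h) - f x) @[h --> 0^'] --> df.
Proof.
case=> fx <-; suff -> : (fun h => h^-1 * (f (x + h) - f x)) =
    (fun h => h^-1 *: ((f \o shift x) (h *: 1) - f x)) by [].
by apply/funext => h; rewrite /= /GRing.scale/= mulr1 [h + x]addrC.
Qed.

Section polygrowth_seq_theory.
Context {R : realType}.
Local Notation E := (polygrowth_seq R).

Lemma val_series (u : nat -> E) (N n : nat) :
  val (series u N) n = series (fun k => val (u k) n) N.
Proof.
rewrite !seriesEnat/=; elim: N => [|N IHN]; first by rewrite !big_nil.
by rewrite !big_nat_recr//=; exact: (congr1 (+%R^~ _) IHN).
Qed.

Lemma polygrowth_seq_cvg_unique (T : Type) (F : set_system T)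
    {FF : ProperFilter F} (f : T -> E) (x y : E) :
  f @ F --> x -> f @ F --> y -> x = y.
Proof.
move=> /polygrowth_seq_cvgP fx /polygrowth_seq_cvgP fy.
apply/val_inj/funext => n.
exact: (cvg_unique _ (fx n) (fy n)).
Qed.

(** Limits in [E] are unique, so [xget] can only pick [g t], never its default value. *)
Lemma curve_derivE (f g : R -> E) :
  (forall t, has_derivative f t (g t)) -> curve_deriv f = g.
Proof.
move=> fg; apply/funext => t; rewrite /curve_deriv.
case: xgetP => [l _ fl|/(_ (g t))/(_ (fg t))//].
exact: polygrowth_seq_cvg_unique fl (fg t).
Qed.

End polygrowth_seq_theory.

(** * Derivatives and Taylor series of the sine curve *)

Section sine_curve_derivatives.
Context {R : realType}.
Local Notation E := (polygrowth_seq R).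
Implicit Types (t u a : R) (k n : nat).

(** The phase shift gives one formula for all orders, with no case distinction on [k] modulo 4. *)
Definition sin_curve_derivn_coord k t n : R :=
  n.+1%:R ^+ k * sin (n.+1%:R * t + k%:R * (pi / 2)).

Lemma sin_curve_derivn_polygrowth k t :
  sin_curve_derivn_coord k t \in polygrowth.
Proof.
(* The exponent is [k.+1] because it must be positive even for [k = 0]. *)
apply/asboolP; exists k.+1 => //; exists 1 => n.
rewrite /sin_curve_derivn_coord normrM normrX normr_nat mulrAC exprS.
rewrite invfM mulrCA mulfV ?expf_neq0 ?pnatr_eq0// mulr1.
rewrite -[leRHS]mulr1 ler_pM//.
  by rewrite invf_le1 ?ltr0n ?ler1n.
by rewrite ler_norml sin_geN1 sin_le1.
Qed.

Definition sin_curve_derivn k t : E :=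
  exist _ (sin_curve_derivn_coord k t) (sin_curve_derivn_polygrowth k t).

Lemma sin_curve_derivn0 : sin_curve_derivn 0 = sin_curve.
Proof.
apply/funext => t; apply/val_inj/funext => n /=.
by rewrite /sin_curve_derivn_coord expr0 mul0r addr0 mul1r.
Qed.

Lemma is_derive_sin_curve_derivn_coord k n t :
  is_derive t 1 (fun s => sin_curve_derivn_coord k s n)
    (sin_curve_derivn_coord k.+1 t n).
Proof.
have -> : sin_curve_derivn_coord k.+1 t n =
    n.+1%:R ^+ k.+1 * cos (n.+1%:R * t + k%:R * (pi / 2)).
  rewrite /sin_curve_derivn_coord -sinDpihalf; congr (_ * sin _).
  by rewrite -[k.+1%:R]natr1; ring.
rewrite /sin_curve_derivn_coord; apply: is_derive_eq.
rewrite /GRing.scale/= exprS; ring.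
Qed.

Lemma has_derivative_sin_curve_derivn k t :
  has_derivative (sin_curve_derivn k) t (sin_curve_derivn k.+1 t).
Proof.
apply/polygrowth_seq_cvgP => n.
exact: (is_derive1_cvg (is_derive_sin_curve_derivn_coord k n t)).
Qed.

Lemma continuous_sin_curve_derivn k : continuous (sin_curve_derivn k).
Proof.
move=> t; apply/polygrowth_seq_cvgP => n /=.
have [/derivable1_diffP/differentiable_continuous] :=
  is_derive_sin_curve_derivn_coord k n t.
exact.
Qed.

Lemma curve_derivn_sin_curve k : curve_derivn k sin_curve = sin_curve_derivn k.
Proof.
elim: k => [|k IHk]; first by rewrite sin_curve_derivn0.
rewrite /curve_derivn iterS -/(curve_derivn k _) IHk.
exact/curve_derivE/has_derivative_sin_curve_derivn.
Qed.

Lemma cvg_series_sin_coeff u : series (sin_coeff u) @ \oo --> sin u.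
Proof. by rewrite unlock; exact: is_cvg_series_sin_coeff. Qed.

Lemma cvg_series_cos_coeff u : series (cos_coeff u) @ \oo --> cos u.
Proof. by rewrite unlock; exact: is_cvg_series_cos_coeff. Qed.

(** The two parity factors are those of [cos_coeff] and [sin_coeff]. The induction goes in steps of
    two, each adding [pi] and flipping the sign. *)
Lemma sin_addn_pihalf a k :
  sin (a + k%:R * (pi / 2)) = sin a * ((~~ odd k)%:R * (-1) ^+ k./2)
    + cos a * ((odd k)%:R * (-1) ^+ k.-1./2).
Proof.
elim/ltn_ind: k => -[|[|k]] IHk.
- by rewrite !mul0r addr0 !mulr1 mulr0 addr0.
- by rewrite mul1r sinDpihalf !mul0r mulr0 add0r !mulr1.
have -> : a + k.+2%:R * (pi / 2) = a + k%:R * (pi / 2) + pi.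
  by rewrite -[k.+2]addn2 natrD; field.
(* At [k = 0] the predecessor in [k.-1./2] truncates, but there the parity factor is 0. *)
rewrite sinDpi IHk//= !negbK; case: k {IHk} => [|k] /=.
  by rewrite !expr0 expr1 !mul0r; ring.
by rewrite !exprS; ring.
Qed.

(** By the addition formula, this is [sin a] times the cosine series plus [cos a] times the sine
    series. *)
Lemma cvg_sin_taylor a u :
  series (fun k => u ^+ k * (k`!%:R^-1 * sin (a + k%:R * (pi / 2)))) @ \oo
    --> sin (a + u).
Proof.
rewrite [X in series X](_ : _ = sin a *: cos_coeff u + cos a *: sin_coeff u).
  rewrite seriesD !seriesZ sinD.
  by apply: cvgD; apply: cvgMr;
    [exact: cvg_series_cos_coeff|exact: cvg_series_sin_coeff].
apply/funext => k; rewrite sin_addn_pihalf.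
by rewrite !fctE /cos_coeff /sin_coeff /GRing.scale/= -exprnP; ring.
Qed.

(** In coordinate [n], the factor [n.+1%:R ^+ k] of the derivative merges with [(t - u) ^+ k],
    leaving the Taylor series of sine with increment [n.+1%:R * (t - u)]. *)
Lemma cvg_sin_curve_taylor t u :
  series (fun k => (t - u) ^+ k *: (k`!%:R^-1 *: sin_curve_derivn k u)) @ \oo
    --> (sin_curve t : E).
Proof.
apply/polygrowth_seq_cvgP => n.
have := @cvg_sin_taylor (n.+1%:R * u) (n.+1%:R * (t - u)).
rewrite -mulrDr [u + _]addrC subrK.
suff -> : series (fun k => (n.+1%:R * (t - u)) ^+ k *
    (k`!%:R^-1 * sin (n.+1%:R * u + k%:R * (pi / 2)))) =
  (fun N => val (series (fun k => (t - u) ^+ k *: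
    (k`!%:R^-1 *: sin_curve_derivn k u)) N) n) by [].
apply/funext => N; rewrite val_series; congr (series _ N); apply/funext => k.
rewrite [RHS](_ : _ = (t - u) ^+ k * (k`!%:R^-1 *
  (n.+1%:R ^+ k * sin (n.+1%:R * u + k%:R * (pi / 2)))))//.
by rewrite exprMn; ring.
Qed.

End sine_curve_derivatives.

(** * Power series in the complexification *)

Section complexification_power_series.
Local Open Scope complex_scope.
Context {R : realType}.
Local Notation E := (polygrowth_seq R).

Lemma complex_analytic_at0 (G : tvsType R[i]) (V : set R[i]^o) (h : R[i] -> G) :
  V 0 -> complex_analytic V h -> exists (a : nat -> G) (r : R), 0 < r /\
    forall z : R[i], `|z| < r%:C -> series (fun n => z ^+ n *: a n) @ \oo --> h z.
Proof.
move=> V0 /(_ _ V0)[a] /nbhs_ballP[e /= e0 ae]; exists a, (complex.Re e).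
(* The radius is a positive element of [R[i]], hence real. *)
have eE : (complex.Re e)%:C = e.
  by case: e e0 {ae} => x y; rewrite ltcE/= => /andP[/eqP ->].
split; first by rewrite -ltcR eE.
move=> z ze; have := ae z; rewrite subr0; apply.
by rewrite /ball/= sub0r normrN -eE.
Qed.

(** The coordinates of both components are continuous, so one complex series splits into two real
    ones. *)
Lemma complexification_series_coord (z : R[i]) (a : nat -> complexification E)
    (w : complexification E) (n : nat) :
  series (fun k => z ^+ k *: a k) @ \oo --> w ->
  series (fun k => complex.Re (z ^+ k) * val (a k).1 n
                 - complex.Im (z ^+ k) * val (a k).2 n) @ \oo --> val w.1 n /\
  series (fun k => complex.Re (z ^+ k) * val (a k).2 n
                 + complex.Im (z ^+ k) * val (a k).1 n) @ \oo --> val w.2 n.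
Proof.
move=> aw.
have aE N : series (fun k => z ^+ k *: a k) N =
   (series (fun k => complex.Re (z ^+ k) *: (a k).1 - complex.Im (z ^+ k) *: (a k).2) N,
    series (fun k => complex.Re (z ^+ k) *: (a k).2 + complex.Im (z ^+ k) *: (a k).1) N).
  elim: N => [|N IHN]; first by rewrite !seriesEnat/= !big_nil.
  rewrite !seriesSr IHN; by case: (z ^+ N) => p q.
have c1 : continuous (fun v : complexification E => val v.1 n : R).
  move=> v; apply: (@continuous_comp _ _ _ (@fst E E) (fun x => val x n : R)).
    exact: cvg_fst.
  exact: polygrowth_seq_coord_continuous.
have c2 : continuous (fun v : complexification E => val v.2 n : R).
  move=> v; apply: (@continuous_comp _ _ _ (@snd E E) (fun x => val x n : R)).
    exact: cvg_snd.
  exact: polygrowth_seq_coord_continuous.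
split.
- have := cvg_comp _ _ aw (c1 w).
  suff -> : (fun v : complexification E => val v.1 n : R) \o
    series (fun k => z ^+ k *: a k) = series (fun k =>
      complex.Re (z ^+ k) * val (a k).1 n - complex.Im (z ^+ k) * val (a k).2 n) by [].
  by apply/funext => N; rewrite /= aE/= val_series.
- have := cvg_comp _ _ aw (c2 w).
  suff -> : (fun v : complexification E => val v.2 n : R) \o
    series (fun k => z ^+ k *: a k) = series (fun k =>
      complex.Re (z ^+ k) * val (a k).2 n + complex.Im (z ^+ k) * val (a k).1 n) by [].
  by apply/funext => N; rewrite /= aE/= val_series.
Qed.

Lemma imaginaryX (y : R) n : (0 +i* y) ^+ n =
  ((~~ odd n)%:R * (-1) ^+ n./2 * y ^+ n) +i* ((odd n)%:R * (-1) ^+ n./2 * y ^+ n).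
Proof.
elim: n => [|n IHn]; first by rewrite !expr0 !mul1r mul0r mul0r.
apply/eqP; rewrite exprS IHn eq_complex/= uphalf_half exprD; case: (odd n) => /=.
  by rewrite !exprS !expr0; apply/andP; split; apply/eqP; ring.
by rewrite exprS expr0; apply/andP; split; apply/eqP; ring.
Qed.

End complexification_power_series.

(** * Failure of real analyticity *)

Section sine_curve_not_analytic.
Local Open Scope complex_scope.
Context {R : realType}.
Local Notation E := (polygrowth_seq R).

(** Meant for [sinh] of [n.+1%:R * y], which dominates each term of its series. Against a growth
    exponent [m], the odd power [2 * m + 1] leaves at least a multiple of [n.+1%:R] after division,
    which is unbounded. *)
Lemma not_polynomial_growth_of_odd_powers (x : nat -> R) (y : R) : 0 < y ->
  (forall n k, odd k -> (n.+1%:R * y) ^+ k / k`!%:R <= x n) ->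
  ~ polynomial_growth x.
Proof.
move=> y0 xge [m _ [M xM]]; pose k := m.*2.+1.
pose c := y ^+ k / k`!%:R.
have c0 : 0 < c by rewrite divr_gt0 ?exprn_gt0// ltr0n fact_gt0.
have cM n : n.+1%:R * c <= M.
  apply: le_trans (xM n); have n0 : 0 < n.+1%:R ^+ m :> R by rewrite exprn_gt0.
  rewrite ler_pdivlMr//; apply: le_trans (ler_norm _).
  apply: le_trans (xge n k _); last by rewrite /k/= odd_double.
  rewrite exprMn -[leRHS]mulrA -/c mulrAC ler_wpM2r ?(ltW c0)//.
  rewrite -exprS ler_weXn2l ?ler1n// /k ltnS -addnn; exact: leq_addr.
have M0 : 0 <= M / c by rewrite divr_ge0// ?(ltW c0)// (le_trans _ (cM 0%N))// mul1r ltW.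
have := archi_boundP M0; set b := (X in X%:R); rewrite ltr_pdivrMr// => /(le_lt_trans (cM b)).
by rewrite ltr_pM2r// ltr_nat ltnNge leqnSn.
Qed.

Lemma sin_curve_not_real_analytic : ~ real_analytic_curve (sin_curve : R -> E).
Proof.
move=> [V [h [_ VR hV hf]]].
have [a [r [r0 ar]]] := complex_analytic_at0 (VR 0) hV.
(* At real points the scalars [t ^+ k] are real, so the two components do not mix. *)
have real_series t n : 0 < t < r ->
    series (fun k => val (a k).1 n * t ^+ k) @ \oo --> sin (n.+1%:R * t) /\
    series (fun k => val (a k).2 n * t ^+ k) @ \oo --> (0 : R).
  move=> /andP[t0 tr].
  have := ar t%:C; rewrite normc_def/= expr0n addr0 sqrtr_sqr gtr0_norm// ltcR.
  move=> /(_ tr) /complexification_series_coord => /(_ n); rewrite hf/=.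
  have -> : (fun k => complex.Re (t%:C ^+ k) * val (a k).1 n
      - complex.Im (t%:C ^+ k) * val (a k).2 n) = (fun k => val (a k).1 n * t ^+ k).
    by apply/funext => k; rewrite -rmorphXn/= mul0r subr0 mulrC.
  have -> : (fun k => complex.Re (t%:C ^+ k) * val (a k).2 n
      + complex.Im (t%:C ^+ k) * val (a k).1 n) = (fun k => val (a k).2 n * t ^+ k).
    by apply/funext => k; rewrite -rmorphXn/= mul0r addr0 mulrC.
  by [].
have a2 k n : val (a k).2 n = 0.
  exact: (power_series_eq0 r0 (fun t tr => proj2 (real_series t n tr))).
have a1 k n : val (a k).1 n = sin_coeff (n.+1%:R : R) k.
  apply: (power_series_inj r0 (fun t tr => proj1 (real_series t n tr))) => t tr.
  have := @cvg_series_sin_coeff R (n.+1%:R * t).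
  suff -> : sin_coeff (n.+1%:R * t) =
    (fun k => sin_coeff (n.+1%:R : R) k * t ^+ k) by [].
  by apply/funext => j; rewrite /sin_coeff/= exprMn; ring.
have [y y0 yr] : exists2 y : R, 0 < y & `|0 +i* y| < r%:C.
  exists (r / 2); first by rewrite divr_gt0.
  rewrite normc_def/= expr0n add0r sqrtr_sqr gtr0_norm ?divr_gt0// ltcR; lra.
(* The second component of [h] at [0 +i* y] lies in [E], so it grows polynomially; lower bounds by
   odd powers will contradict this. *)
apply: (@not_polynomial_growth_of_odd_powers (val (h (0 +i* y)).2) y y0); last first.
  exact/asboolP/(valP (h (0 +i* y)).2).
move=> n k ok.
(* The terms of the series of [sinh] at [n.+1%:R * y]. *)
pose s j := (odd j)%:R * (n.+1%:R * y) ^+ j / j`!%:R.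
have s0 j : 0 <= s j.
  by rewrite mulr_ge0 ?invr_ge0 ?ler0n// mulr_ge0// exprn_ge0// mulr_ge0// ltW.
have [_] := complexification_series_coord n (ar _ yr).
rewrite (_ : (fun _ => _) = s); last first.
  apply/funext => j; rewrite imaginaryX/= a1 a2 mulr0 add0r /sin_coeff/= /s.
  case oj: (odd j); last by rewrite !mul0r.
  (* For odd [j] the sign of the sine coefficient equals that of the imaginary part of the power, so
     their product is 1. *)
  have -> : j.-1./2 = j./2 by case: j oj => //= j /negPf; rewrite uphalf_half => ->.
  have e : (-1) ^+ j./2 * (-1) ^+ j./2 = 1 :> R by rewrite -exprMn mulrNN mulr1 expr1n.
  move: e; set w := (-1) ^+ _ => e; rewrite !mul1r exprMn.
  transitivity (w * w * (n.+1%:R ^+ j * y ^+ j / j`!%:R)); first by ring.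
  by rewrite e mul1r.
move=> sx; rewrite -(cvg_lim _ sx)//.
(* All terms are nonnegative, so the sum dominates the partial sum containing term [k], and that
   dominates the term itself. *)
apply: (@le_trans _ _ (series s k.+1)).
  rewrite seriesSr {2}/s ok mul1r lerDr seriesEnat/=.
  by apply: sumr_ge0 => j _.
apply: nondecreasing_cvgn_le; last by apply/cvg_ex; eexists; exact: sx.
by apply/nondecreasing_seqP => j; rewrite seriesSr lerDl.
Qed.

End sine_curve_not_analytic.

Theorem proposition4p2 (R : realType) :
  let f : R -> polygrowth_seq R := sin_curve in
  [/\ smooth_curve f,
      forall t t0 : R,
        series (fun k => (t - t0) ^+ k *: (k`!%:R^-1 *: curve_derivn k f t0))
          @ \oo --> f t &
      ~ real_analytic_curve f].
Proof.
move=> f; split; last exact: sin_curve_not_real_analytic.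
- move=> k; rewrite !curve_derivn_sin_curve; split.
    exact: continuous_sin_curve_derivn.
  by move=> t; exact: has_derivative_sin_curve_derivn.
- move=> t t0; have := @cvg_sin_curve_taylor R t t0.
  suff -> : (fun k => (t - t0) ^+ k *: (k`!%:R^-1 *: curve_derivn k f t0)) =
    (fun k => (t - t0) ^+ k *: (k`!%:R^-1 *: sin_curve_derivn k t0)) by [].
  by apply/funext => k; rewrite curve_derivn_sin_curve.
Qed.
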